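(* Let $H$ be a graph (possibly with loops). There is a constant $c_H$ such that if $n \geq c_H$ and $T$ is a tree on $n$ vertices, then $$\hom(T,H) \leq \hom(K_{1,n-1},H),$$ with equality if and only if $H$ is regular or $T = K_{1,n-1}$.
   Context: Trees are simple and loopless; the target graph $H$ may have loops but has no multiple edges. For a simple loopless graph $G$ and a graph $H$, an $H$-coloring of $G$ is a map $f: V(G) \to V(H)$ such that $f(x)$ and $f(y)$ are adjacent in $H$ whenever $x$ and $y$ are adjacent in $G$; $\hom(G,H)$ is the number of $H$-colorings of $G$. The degree of a vertex $v$ is $d(v) = |\{w : v \sim w\}|$, so a loop at $v$ adds exactly one to its degree; a graph is regular if all its vertices have the same degree in this sense. $K_{1,n-1}$ is the star on $n$ vertices. The constant $c_H$ depends on $H$ but not on $n$ or $T$.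
   Formalization: In the equality clause, ''H is regular'' is replaced by ''every connected component of H is regular''; as stated the ''only if'' fails for disconnected H, e.g. a looped vertex plus an isolated vertex, where equality holds for every tree with n ≥ 2. For connected H nothing changes. *)

(* Defs.v *)
From mathcomp Require Import all_boot.

Set Implicit Arguments.
Unset Strict Implicit.
Unset Printing Implicit Defensive.

(* A graph is a symmetric relation on a finType: loops are allowed, multiple
   edges are not.  Loopless graphs are those whose relation is also
   irreflexive. *)

Definition is_hcoloring (V W : finType) (eG : rel V) (eH : rel W)
    (f : {ffun V -> W}) : bool :=
  [forall x, forall y, eG x y ==> eH (f x) (f y)].

Definition hom (V W : finType) (eG : rel V) (eH : rel W) : nat :=
  #|[set f : {ffun V -> W} | is_hcoloring eG eH f]|.

(* A loop at v makes v a member of its own neighbourhood, so it adds one. *)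
Definition degree (V : finType) (e : rel V) (v : V) : nat :=
  #|[set w | e v w]|.

Definition regular (V : finType) (e : rel V) : Prop :=
  forall u v : V, degree e u = degree e v.

Definition induced (V : finType) (e : rel V) (A : pred V) : rel {x : V | A x} :=
  fun x y => e (val x) (val y).
Arguments induced {V} e A.

(* Degrees may differ between components.  If every component H_i is regular of
   degree d_i, then hom(T,H) = \sum_i |H_i| d_i^(n-1) for every tree T on n
   vertices, so this, rather than regularity of a possibly disconnected H, is
   what characterizes equality of all trees with the star.  The two agree on
   connected graphs: see [connected_components_regular]. *)
Definition components_regular (V : finType) (e : rel V) : Prop :=
  forall v : V, regular (induced e (connect e v)).

Definition connected (V : finType) (e : rel V) : Prop :=
  0 < #|V| /\ forall u v : V, connect e u v.

(* [ucycle] also accepts the empty sequence, a looped vertex, and an edge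
   traversed back and forth, hence the bound 3. *)
Definition acyclic (V : finType) (e : rel V) : Prop :=
  forall c : seq V, ucycle e c -> size c < 3.

Definition is_tree (V : finType) (e : rel V) : Prop :=
  [/\ symmetric e, irreflexive e, connected e & acyclic e].

Definition complete_bipartite (a b : nat) : rel ('I_a + 'I_b)%type :=
  fun x y => match x, y with
             | inl _, inr _ | inr _, inl _ => true
             | _, _ => false
             end.

(* K_{1,n-1}; it has n vertices when 0 < n. *)
Definition star (n : nat) : rel ('I_1 + 'I_n.-1)%type :=
  @complete_bipartite 1 n.-1.
Arguments star n : clear implicits.

Definition graph_iso (V W : finType) (e : rel V) (e' : rel W) : Prop :=
  exists2 f : V -> W, bijective f & forall x y : V, e' (f x) (f y) = e x y.

Lemma degree_component (V : finType) (e : rel V) (v : V)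
    (x : {x : V | connect e v x}) :
  degree (induced e (connect e v)) x = degree e (val x).
Proof.
rewrite /degree -(card_imset _ val_inj); apply: eq_card => w.
rewrite inE; apply/imsetP/idP => [[y]|exw]; first by rewrite inE => exy ->.
have vw : connect e v w := connect_trans (valP x) (connect1 exw).
by exists (Sub w vw); rewrite ?inE.
Qed.

Lemma regular_components (V : finType) (e : rel V) :
  regular e -> components_regular e.
Proof. by move=> reg v x y; rewrite !degree_component. Qed.

Lemma connected_components_regular (V : finType) (e : rel V) :
  connected e -> components_regular e <-> regular e.
Proof.
move=> [_ conn]; split=> [creg u v|]; last exact: regular_components.
have := creg u (Sub u (connect0 e u)) (Sub v (conn u v)).
by rewrite !degree_component.
Qed.

(* Main.v *)
From mathcomp Require Import all_boot all_order perm all_algebra zify ring.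
Require Import Defs.

Set Implicit Arguments.
Unset Strict Implicit.
Unset Printing Implicit Defensive.

Import Order.TTheory GRing.Theory Num.Theory.

(** Write d(x) for the degree of x in H, and n for the number of vertices of T.
The star satisfies hom(K_{1,n-1}, H) = \sum_x d(x)^(n-1), so for n >= 3 the
inequality says that this power sum bounds hom(T, H); the constant 3 works for
every H.  The argument is the importance sampling of Levin and Peres.

Give an H-coloring f of T the weight w(f) = \prod_v d(f v)^(1 - deg v).  Up to
the factor \sum_x d(x), this is the probability that a random walk on H indexed
by T, started from its stationary law (proportional to d) and branching at each
vertex into independent uniform steps, traces out f.  By stationarity every f(v)
has the same law, whichever vertex v of T is observed ([weight_marginal]):
  \sum_f w(f) phi(f v) = \sum_x d(x) phi(x).
Hence hom(T, H) = \sum_f w(f) \prod_v d(f v)^(deg v - 1).  The exponents are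
natural numbers with sum n - 2 ([tree_handshake]), so the weighted
arithmetic-geometric mean inequality ([weighted_AGM]) bounds each product by the
average of the d(f v)^(n-2) with coefficients (deg v - 1) / (n - 2); summing
against w, each of these powers contributes \sum_x d(x)^(n-1), and the bound
follows.

Equality holds iff for each f the value d(f v) is the same at all internal
vertices v, those with deg v > 1 ([hom_tree_leif]).  If T is not a star it has
two adjacent internal vertices ([star_or_adjacent_internal]), and since T is
bipartite these can be sent to the ends of any edge of H ([edge_hcoloring]); so
d is then constant along edges of H, which means that the components of H are
regular.  Conversely, if d is constant along edges of H, it is constant along
every coloring, since T is connected. *)

(** * Leaves and induction on trees *)

Section Leaf.
Variables (V : finType) (e : rel V).

(** A path that cannot be extended at its head starts at a leaf: an additional
neighbour of the head would have to lie further along the path, closing a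
cycle. *)
Lemma acyclic_path_leaf x p : symmetric e -> irreflexive e -> acyclic e ->
  path e x p -> uniq (x :: p) -> 0 < size p ->
  exists l q, e l =1 pred1 q.
Proof.
move=> symE irrE acyE.
have [k] := ubnP (#|V| - size p); elim: k x p => // k IHk x [//|y p] ltk.
move=> xyp Uxyp _.
have leV (s : seq V) : uniq s -> size s <= #|V|.
  by move/card_uniqP <-; apply: max_card.
have [z /andP[exz z'xyp]|x_nbr] := pickP [pred z | e x z & z \notin x :: y :: p].
  apply: (IHk z [:: x, y & p]) => //=.
  - by have := leV _ Uxyp; move: ltk => /=; lia.
  - by move: xyp; rewrite /= (symE z) exz.
  - by rewrite -!cons_uniq cons_uniq z'xyp.
exists x, y => z; rewrite /=; apply/idP/eqP=> [exz|->]; last by case/andP: xyp.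
have:= x_nbr z; rewrite /= exz /= => /negbFE; rewrite !inE.
have [zx|_ /=] := eqVneq z x; first by rewrite zx irrE in exz.
have [//|_ /= z_p] := eqVneq z y.
case/splitPr: z_p xyp Uxyp {IHk ltk x_nbr} => p1 p2.
rewrite -cat_rcons -!cat_cons cat_path cat_uniq => /andP[xp1z _] /andP[Up1z _].
have /acyE : ucycle e (x :: y :: rcons p1 z).
  rewrite /ucycle Up1z andbT.
  change (path e x (rcons (y :: rcons p1 z) x)); rewrite rcons_path xp1z.
  by rewrite /= last_rcons (symE z).
by rewrite /= size_rcons.
Qed.

Lemma tree_has_leaf : is_tree e -> 1 < #|V| -> exists l q, e l =1 pred1 q.
Proof.
case=> symE irrE [_ conE] acyE /card_gt1P[u [v [_ _ neq_uv]]].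
have /connectP[p u_p def_v] := conE u v.
case/shortenP: u_p def_v => p' u_p' Up' _ def_v.
apply: (acyclic_path_leaf symE irrE acyE u_p' Up').
by case: p' {u_p' Up'} def_v => //= def_v; rewrite def_v eqxx in neq_uv.
Qed.

Lemma leaf_nbr_neq l q : irreflexive e -> e l =1 pred1 q -> q != l.
Proof. by move=> irrE lq; apply/eqP=> ql; have:= lq q; rewrite /= eqxx ql irrE. Qed.

(** Connectivity survives because sending the leaf to its neighbour retracts the
tree onto the remaining vertices. *)
Lemma tree_remove_leaf l q : e l =1 pred1 q -> is_tree e ->
  is_tree (induced e (predC1 l)).
Proof.
move=> lq [symE irrE [_ conE] acyE].
have q'l := leaf_nbr_neq irrE lq.
split=> [x y|x||c]; rewrite /induced /=; [exact: symE|exact: irrE| |].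
  split; first by apply/card_gt0P; exists (Sub q q'l).
  pose r x : {x | predC1 l x} := insubd (Sub q q'l) x.
  have homo_r x y : e x y ->
      connect (fun u v : {x | predC1 l x} => e (val u) (val v)) (r x) (r y).
    have rl : r l = Sub q q'l by apply: val_inj; rewrite val_insubd /= eqxx.
    have [->|x'l] := eqVneq x l; last have [->|y'l] := eqVneq y l.
    - rewrite lq => /eqP->; rewrite rl.
      suff ->: r q = Sub q q'l by [].
      by apply: val_inj; rewrite val_insubd /= q'l.
    - rewrite symE lq => /eqP->; rewrite rl.
      suff ->: r q = Sub q q'l by [].
      by apply: val_inj; rewrite val_insubd /= q'l.
    by move=> exy; apply: connect1; rewrite !val_insubd /= x'l y'l.
  move=> u v; rewrite -[u](valKd (Sub q q'l)) -[v](valKd (Sub q q'l)) -/(r _) -/(r _).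
  have /connectP[p] := conE (val u) (val v).
  elim: p (val u) => [|y p IHp] x /=; first by move=> _ ->.
  by case/andP=> exy yp def_v; apply: connect_trans (homo_r _ _ exy) (IHp _ yp def_v).
case/andP=> cyc_c Uc; rewrite -(size_map val) acyE // /ucycle.
by rewrite cycle_map cyc_c map_inj_uniq //; apply: val_inj.
Qed.

End Leaf.

(** The type of vertices has to vary along the induction, since removing a leaf
moves to a subtype. *)
Lemma tree_leaf_ind (P : forall V : finType, rel V -> Prop) :
  (forall (V : finType) (e : rel V) v, is_tree e -> (forall u : V, u = v) -> P V e) ->
  (forall (V : finType) (e : rel V) l q, is_tree e -> e l =1 pred1 q ->
     P _ (induced e (predC1 l)) -> P V e) ->
  forall (V : finType) (e : rel V), is_tree e -> P V e.
Proof.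
move=> P1 Pleaf V; have [n] := ubnP #|V|.
elim: n V => // n IHn V ltn e treeE.
have [V_gt1|V_le1] := ltnP 1 #|V|.
  have [l [q lq]] := tree_has_leaf treeE V_gt1.
  apply: (Pleaf _ _ l q) => //; apply: IHn; last exact: tree_remove_leaf lq treeE.
  by rewrite card_sig cardC1; move: ltn V_gt1; lia.
have [_ _ [/card_gt0P[v _] _] _] := treeE.
by apply: (P1 _ _ v treeE) => u; apply: (fintype_le1P V_le1).
Qed.

(** * Degrees and bipartition *)

Lemma big_predC1 (R : Type) (idx : R) (op : Monoid.com_law idx) (V : finType)
    (l : V) (F : V -> R) :
  \big[op/idx]_v F v = op (F l) (\big[op/idx]_(x : {x | predC1 l x}) F (val x)).
Proof. by rewrite (bigD1 l) //= -(big_sub (predC1 l)). Qed.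

Section RemoveLeaf.
Variables (V : finType) (e : rel V) (l q : V).
Hypotheses (symE : symmetric e) (lq : e l =1 pred1 q).

Lemma degree_leaf : degree e l = 1.
Proof. by rewrite -(cards1 q); apply: eq_card => x; rewrite !inE lq. Qed.

Lemma degree_remove_leaf (x : {x | predC1 l x}) :
  degree e (val x) = degree (induced e (predC1 l)) x + (val x == q).
Proof.
rewrite /degree -!sum1dep_card big_mkcond /= (big_predC1 _ l) -big_mkcond /= addnC.
by rewrite symE lq /=; case: eqP.
Qed.

End RemoveLeaf.

(** A tree on n vertices has n - 1 edges, so its degrees add up to 2n - 2. *)
Lemma tree_handshake (V : finType) (e : rel V) :
  is_tree e -> (\sum_v degree e v).+2 = #|V|.*2.
Proof.
move: V e; apply: tree_leaf_ind => [V e v [_ irrE _ _] Vv | V e l q treeE lq IH].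
  have -> : #|V| = 1 by rewrite -(card1 v); apply: eq_card => u; rewrite (Vv u) !inE eqxx.
  rewrite big1 // => u _; apply: eq_card0 => w.
  by rewrite inE (Vv w) (Vv u) irrE.
have [symE irrE _ _] := treeE.
have q'l := leaf_nbr_neq irrE lq.
rewrite (big_predC1 _ l) (degree_leaf lq) /=.
under eq_bigr => x _ do rewrite (degree_remove_leaf symE lq).
have sum_q : \sum_(x : {x | predC1 l x}) (val x == q) = 1.
  rewrite (bigD1 (Sub q q'l)) //= eqxx big1 // => x.
  by rewrite -val_eqE /= => /negbTE->.
rewrite big_split /= sum_q add1n addn1 IH card_sig cardC1 -doubleS prednK //.
by apply/card_gt0P; exists l.
Qed.

Lemma tree_bipartite (V : finType) (e : rel V) : is_tree e ->
  exists c : V -> bool, forall u v, e u v -> c u != c v.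
Proof.
move: V e; apply: tree_leaf_ind => [V e v [_ irrE _ _] Vv | V e l q treeE lq [c cP]].
  by exists xpredT => u w; rewrite (Vv w) (Vv u) irrE.
have [symE irrE _ _] := treeE.
have q'l := leaf_nbr_neq irrE lq.
pose c' v := if insub v is Some v' then c v' else ~~ c (Sub q q'l).
have c'l : c' l = ~~ c (Sub q q'l) by rewrite /c' insubF //= eqxx.
have c'S v (v'l : predC1 l v) : c' v = c (Sub v v'l) by rewrite /c' insubT.
exists c' => u v.
have [->|u'l] := eqVneq u l; last have [->|v'l] := eqVneq v l.
- by rewrite lq c'l => /eqP->; rewrite c'S; case: (c _).
- by rewrite symE lq c'l => /eqP->; rewrite c'S; case: (c _).
by rewrite !c'S => euv; apply: cP.
Qed.

(** * The tree-indexed random walk *)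

Section Weight.
Variables (W : finType) (eH : rel W).
Hypothesis symH : symmetric eH.
Local Open Scope ring_scope.

(** The unnormalized law of the stationary random walk on H indexed by the tree.
Its exponent 1 - deg v is split into a numerator and a denominator so that it
also makes sense for the tree with a single vertex, where the exponent equals 1.
This case starts the induction, and it gives the stationary weight d. *)
Definition weight (V : finType) (e : rel V) (f : {ffun V -> W}) : rat :=
  \prod_v ((degree eH (f v))%:R / (degree eH (f v))%:R ^+ degree e v).

(** The change of variables that splits a sum over colorings of a tree into an
outer sum over colorings of the tree without the leaf l and an inner sum over the
color of l. *)
Definition glue (V : finType) (l : V) (gy : {ffun {x | predC1 l x} -> W} * W) :
    {ffun V -> W} :=
  [ffun x => if insub x is Some x' then gy.1 x' else gy.2].

Lemma glue_leaf V l g y : @glue V l (g, y) l = y.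
Proof. by rewrite ffunE insubF //= eqxx. Qed.

Lemma glue_val V l g y x : @glue V l (g, y) (val x) = g x.
Proof. by rewrite ffunE valK. Qed.

Lemma glue_bij V l : bijective (@glue V l).
Proof.
exists (fun f : {ffun V -> W} =>
          ([ffun x : {x | predC1 l x} => f (val x)], f l)) => [[g y]|f].
  by rewrite glue_leaf; congr pair; apply/ffunP=> x; rewrite ffunE glue_val.
apply/ffunP=> x; have [->|x'l] := eqVneq x l; first by rewrite glue_leaf.
by rewrite -[x]/(val (Sub x x'l : {x | predC1 l x})) glue_val ffunE.
Qed.

Lemma is_hcoloring_glue (V : finType) (e : rel V) l (q : {x | predC1 l x})
    (g : {ffun {x | predC1 l x} -> W}) y :
  symmetric e -> e l =1 pred1 (val q) ->
  is_hcoloring e eH (glue (g, y)) =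
    is_hcoloring (induced e (predC1 l)) eH g && eH (g q) y.
Proof.
move=> symE lq; apply/'forall_'forall_implyP/andP => [col|[/'forall_'forall_implyP col gqy] u v].
  split; last by rewrite -(glue_val g y) -[X in eH _ X](glue_leaf g y) col // symE lq /=.
  by apply/'forall_'forall_implyP=> u v euv; rewrite -!(glue_val g y) col.
have [->|u'l] := eqVneq u l; last have [->|v'l] := eqVneq v l.
- by rewrite lq => /eqP->; rewrite glue_leaf glue_val symH.
- by rewrite symE lq => /eqP->; rewrite glue_leaf glue_val.
rewrite -[u]/(val (Sub u u'l : {x | predC1 l x})).
rewrite -[v]/(val (Sub v v'l : {x | predC1 l x})).
by rewrite !glue_val => euv; apply: col.
Qed.

(** Restoring a leaf multiplies the weight by the transition probability of one
uniform step from the color of its neighbour; the leaf itself has exponent 0. *)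
Lemma weight_glue (V : finType) (e : rel V) l (q : {x | predC1 l x})
    (g : {ffun {x | predC1 l x} -> W}) y :
  symmetric e -> e l =1 pred1 (val q) -> eH (g q) y ->
  weight e (glue (g, y)) =
    weight (induced e (predC1 l)) g / (degree eH (g q))%:R.
Proof.
move=> symE lq gqy; rewrite /weight (big_predC1 _ l) (degree_leaf lq) /=.
rewrite glue_leaf expr1 divff ?mul1r; last first.
  by rewrite pnatr_eq0 -lt0n; apply/card_gt0P; exists (g q); rewrite inE symH.
under eq_bigr => x _ do
  rewrite glue_val (degree_remove_leaf symE lq) exprD invfM mulrA.
rewrite big_split /=; congr (_ * _).
rewrite (bigD1 q) //= eqxx expr1 big1 ?mulr1 // => x.
by rewrite -val_eqE => /negbTE->; rewrite expr0 invr1.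
Qed.

(** Stationarity of the walk, by induction on the tree.  Away from the new leaf,
summing over its color multiplies by a total transition probability 1; at the
new leaf, the law is the image under one step of the law d at its neighbour,
which is d again because H is undirected. *)
Lemma weight_marginal (V : finType) (e : rel V) : is_tree e ->
  forall v (phi : W -> rat),
  \sum_(f | is_hcoloring e eH f) weight e f * phi (f v) =
    \sum_x (degree eH x)%:R * phi x.
Proof.
move: V e; apply: tree_leaf_ind => [V e v [_ irrE _ _] Vv | V e l q treeE lq IH] w phi.
  rewrite (reindex (fun x => [ffun=> x])) /=; last first.
    exists (fun f => f v) => [x|f] _; first by rewrite ffunE.
    by apply/ffunP=> u; rewrite ffunE (Vv u).
  apply: eq_big => [x|x _].
    by apply/'forall_'forall_implyP=> u u'; rewrite (Vv u) (Vv u') irrE.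
  rewrite ffunE /weight (bigD1 v) //= big1 => [|u]; last by rewrite (Vv u) eqxx.
  rewrite ffunE (_ : degree e v = 0%N) ?divr1 ?mulr1 //.
  by apply: eq_card0 => u; rewrite inE (Vv u) irrE.
have [symE irrE _ _] := treeE.
have q'l := leaf_nbr_neq irrE lq.
pose q' : {x | predC1 l x} := Sub q q'l.
have lq' : e l =1 pred1 (val q') by [].
rewrite (reindex (@glue V l)) /=; last exact/onW_bij/glue_bij.
pose P g y := is_hcoloring (induced e (predC1 l)) eH g && eH (g q') y.
rewrite (eq_bigl (fun gy => P gy.1 gy.2)) => [|[g y]]; last first.
  exact: is_hcoloring_glue lq'.
transitivity (\sum_(g | is_hcoloring (induced e (predC1 l)) eH g)
   weight (induced e (predC1 l)) g *
     \sum_(y | eH (g q') y) phi (glue (g, y) w) / (degree eH (g q'))%:R).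
  under [RHS]eq_bigr => g _ do rewrite big_distrr /=.
  rewrite pair_big_dep /=; apply: eq_bigr => -[g y] /andP[_ /= gy].
  by rewrite (weight_glue symE lq' gy); ring.
have [->|w'l] := eqVneq w l.
  pose psi x := \sum_(y | eH x y) phi y / (degree eH x)%:R.
  transitivity (\sum_(g | is_hcoloring (induced e (predC1 l)) eH g)
      weight (induced e (predC1 l)) g * psi (g q')).
    apply: eq_bigr => g _; congr (_ * _).
    by apply: eq_bigr => y _; rewrite glue_leaf.
  rewrite IH /psi /=.
  under eq_bigr => x _ do rewrite big_distrr /=.
  rewrite (exchange_big_dep predT) //=; apply: eq_bigr => y _.
  transitivity (\sum_(x | eH y x) phi y).
    rewrite (eq_bigl (eH y)) => [|x]; last exact: symH.
    apply: eq_bigr => x eyx; rewrite mulrCA divff ?mulr1 //.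
    by rewrite pnatr_eq0 -lt0n; apply/card_gt0P; exists y; rewrite inE symH.
  by rewrite sumr_const /degree cardsE mulr_natl.
have [w' def_w] : exists w' : {x | predC1 l x}, w = val w' by exists (Sub w w'l).
rewrite def_w -(IH w' phi); apply: eq_bigr => g colg.
rewrite (eq_bigr (fun=> phi (g w') / (degree eH (g q'))%:R)) => [|y _]; last first.
  by rewrite glue_val.
rewrite sumr_const /=.
(* An isolated color has no step out of it, but the weight of g then vanishes. *)
have [gq0|gq_gt0] := posnP (degree eH (g q')).
  by rewrite /weight (bigD1 q') //= gq0 !mul0r.
congr (_ * _); rewrite -mulrnAr -[_ *+ _]mulr_natl (_ : #|_| = degree eH (g q')); last first.
  by rewrite /degree cardsE.
by rewrite divff ?mulr1 // pnatr_eq0 -lt0n.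
Qed.

End Weight.

(** * The weighted arithmetic-geometric mean inequality *)

(** The unweighted inequality for the family in which E i ^+ n occurs a i times.
The n-th powers are there to avoid roots: both sides of the unweighted inequality
are then n-th powers. *)
Lemma weighted_AGM (F : numFieldType) (I : finType) (a : I -> nat) (E : I -> F) :
  let n := (\sum_i a i)%N in
  (0 < n)%N -> (forall i, 0 <= E i)%R ->
  (\prod_i E i ^+ a i <= (\sum_i (a i)%:R * E i ^+ n) / n%:R
     ?= iff [forall i, forall j, (0 < a i)%N && (0 < a j)%N ==> (E i == E j)])%R.
Proof.
move=> n n_gt0 E_ge0; pose J : finType := {i : I & 'I_(a i)}.
have cardJ : #|J| = n.
  by rewrite card_tagged sumnE big_map big_enum; apply: eq_bigr => i _; rewrite card_ord.
have sumJ (G : I -> F) :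
    (\sum_(p : J) G (tag p) = \sum_i (a i)%:R * G i)%R.
  rewrite -(sig_big_dep predT (fun _ => predT) (fun i (_ : 'I_(a i)) => G i)) /=.
  by apply: eq_bigr => i _; rewrite sumr_const card_ord mulr_natl.
have prodJ (G : I -> F) : (\prod_(p : J) G (tag p) = \prod_i G i ^+ a i)%R.
  rewrite -(sig_big_dep predT (fun _ => predT) (fun i (_ : 'I_(a i)) => G i)) /=.
  by apply: eq_bigr => i _; rewrite prodr_const card_ord.
have /= := @leif_AGM F J predT (fun p => E (tag p) ^+ n)%R.
rewrite cardJ (sumJ (fun i => E i ^+ n)%R) (prodJ (fun i => E i ^+ n)%R) => /(_ (fun _ _ => exprn_ge0 _ (E_ge0 _))).
under eq_bigr => i _ do rewrite exprAC; rewrite prodrXl => -[leX eqX].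
have X_ge0 : (0 <= \prod_i E i ^+ a i)%R by apply: prodr_ge0 => i _; apply: exprn_ge0.
have mu_ge0 : (0 <= (\sum_i (a i)%:R * E i ^+ n) / n%:R)%R.
  rewrite divr_ge0 ?ler0n ?sumr_ge0 // => i _.
  by rewrite mulr_ge0 ?ler0n ?exprn_ge0.
split; first by rewrite -(ler_pXn2r n_gt0).
rewrite -(eqrXn2 n_gt0) // {}eqX; apply/'forall_'forall_implyP/'forall_forallP.
  move=> eqE i j; apply/implyP=> /andP[ai aj].
  rewrite -(eqrXn2 n_gt0) //.
  exact: (eqE (Tagged _ (Ordinal ai)) (Tagged _ (Ordinal aj)) isT).
move=> eqE [i si] [j sj] _ /=.
have /implyP/(_ _)/eqP-> // := eqE i j.
by rewrite (leq_ltn_trans _ (ltn_ord si)) // (leq_ltn_trans _ (ltn_ord sj)).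
Qed.

(** * Stars, isomorphisms and regular components *)

Lemma hom_star (W : finType) (eH : rel W) n : symmetric eH ->
  hom (star n) eH = \sum_x degree eH x ^ n.-1.
Proof.
move=> symH; pose h (xg : W * {ffun 'I_n.-1 -> W}) : {ffun 'I_1 + 'I_n.-1 -> W} :=
  [ffun t => match t with inl _ => xg.1 | inr i => xg.2 i end].
rewrite /hom -sum1dep_card (reindex h) /=; last first.
  exists (fun f : {ffun 'I_1 + 'I_n.-1 -> W} =>
    (f (inl ord0), [ffun i => f (inr i)])) => [[x g]|f] _.
    by rewrite ffunE /=; congr pair; apply/ffunP=> i; rewrite !ffunE.
  by apply/ffunP=> -[i|i]; rewrite !ffunE //= (ord1 i).
pose Q x (g : {ffun 'I_n.-1 -> W}) := g \in ffun_on [set y | eH x y].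
rewrite (eq_bigl (fun xg => Q xg.1 xg.2)) => [|[x g]]; last first.
  apply/'forall_'forall_implyP/ffun_onP => [col i | gP [i|i] [j|j] //= _].
  - by have := col (inl ord0) (inr i) isT; rewrite !ffunE inE.
  - by have := gP j; rewrite !ffunE inE.
  by have := gP i; rewrite !ffunE inE symH.
rewrite -(pair_big_dep predT Q (fun _ _ => 1)) /=; apply: eq_bigr => x _.
by rewrite sum1_card card_ffun_on card_ord.
Qed.

Lemma hom_graph_iso (V V' W : finType) (e : rel V) (e' : rel V') (eH : rel W) :
  graph_iso e e' -> hom e eH = hom e' eH.
Proof.
case=> f [f' fK f'K] fE; rewrite /hom -!sum1dep_card.
rewrite (reindex (fun g : {ffun V' -> W} => [ffun x => g (f x)])) /=; last first.
  exists (fun g : {ffun V -> W} => [ffun x => g (f' x)]) => g _;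
    by apply/ffunP=> x; rewrite !ffunE ?fK ?f'K.
apply: eq_bigl => g; apply/'forall_'forall_implyP/'forall_'forall_implyP => col u v.
  by rewrite -[u]f'K -[v]f'K fE => /col; rewrite !ffunE.
by rewrite -fE => /col; rewrite !ffunE.
Qed.

Lemma components_regularP (W : finType) (eH : rel W) :
  components_regular eH <-> forall x y, eH x y -> degree eH x = degree eH y.
Proof.
split=> [reg x y exy | dE x].
  have := reg x (Sub x (connect0 _ _)) (Sub y (connect1 exy)).
  by rewrite !degree_component.
suff dx (y : {y | connect eH x y}) : degree eH (val y) = degree eH x.
  by move=> y z; rewrite !degree_component !dx.
case: y => _ /= /connectP[p xp ->].
by elim: p x xp => //= y p IHp x /andP[exy /IHp->]; rewrite (dE x y).
Qed.

Lemma tree_degree_gt0 (V : finType) (e : rel V) v : is_tree e ->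
  1 < #|V| -> 0 < degree e v.
Proof.
case=> symE irrE [_ conE] _ V_gt1.
have [u neq_uv] : exists u, u != v.
  have /card_gt1P[x [y [_ _ neq_xy]]] := V_gt1.
  have [xv|] := eqVneq x v; last by exists x.
  by exists y; rewrite -xv eq_sym.
have /connectP[[|w p] /=] := conE v u; first by move=> _ uv; rewrite uv eqxx in neq_uv.
by case/andP=> evw _ _; apply/card_gt0P; exists w; rewrite inE.
Qed.

Lemma hcoloring_connected_eq (V W : finType) (e : rel V) (eH : rel W)
    (T : Type) (F : W -> T) (f : {ffun V -> W}) :
  connected e -> (forall x y, eH x y -> F x = F y) -> is_hcoloring e eH f ->
  forall u v, F (f u) = F (f v).
Proof.
move=> [_ conE] FE /'forall_'forall_implyP col u v.
have /connectP[p] := conE u v.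
elim: p u => [|w p IHp] u /=; first by move=> _ ->.
by case/andP=> /col/FE-> wp /(IHp _ wp).
Qed.

(** * Colorings of a tree *)

Section TreeHom.
Variables (V W : finType) (e : rel V) (eH : rel W).
Hypotheses (treeE : is_tree e) (symH : symmetric eH).

(** Each coloring satisfies the weighted mean inequality for the numbers d (f v)
with multiplicities deg v - 1, which vanish at the leaves; this explains why the
equality condition involves internal vertices only. *)
Lemma hom_tree_leif : 2 < #|V| ->
  (((hom e eH)%:R : rat) <= (\sum_x degree eH x ^ #|V|.-1)%N%:R
    ?= iff [forall (f | is_hcoloring e eH f), forall u, forall v,
             (1 < degree e u)%N && (1 < degree e v)%N ==>
             (degree eH (f u) == degree eH (f v))])%R.
Proof.
move=> V_gt2; pose n := (\sum_v (degree e v).-1)%N.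
have deg_gt0 v : 0 < degree e v := tree_degree_gt0 v treeE (ltnW V_gt2).
have def_n : n.+2 = #|V|.
  have := tree_handshake treeE.
  rewrite (eq_bigr (fun v => (degree e v).-1 + 1)) => [|v _]; last by rewrite addn1 prednK.
  by rewrite big_split /= (sum1_card V) -/n -addnn -!addSn => /addIn.
have n_gt0 : 0 < n by move: V_gt2; rewrite -def_n.
pose d x : rat := ((degree eH x)%:R)%R.
have d_gt0 f v : is_hcoloring e eH f -> (0 < d (f v))%R.
  move=> /'forall_'forall_implyP col; rewrite ltr0n.
  have /card_gt0P[w] := deg_gt0 v; rewrite inE => /col fvw.
  by apply/card_gt0P; exists (f w); rewrite inE.
have -> : ((hom e eH)%:R = \sum_(f | is_hcoloring e eH f)
    weight eH e f * \prod_v d (f v) ^+ (degree e v).-1)%R.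
  rewrite /hom -sum1dep_card natr_sum; apply: eq_bigr => f col.
  rewrite /weight -big_split /= big1 // => v _.
  rewrite -/(d (f v)) -{1}(prednK (deg_gt0 v)) exprS invfM mulrA.
  by rewrite divff ?mul1r ?mulVf ?expf_neq0 // gt_eqF // d_gt0.
have -> : ((\sum_x degree eH x ^ #|V|.-1)%N%:R = \sum_(f | is_hcoloring e eH f)
    weight eH e f * ((\sum_v (degree e v).-1%:R * d (f v) ^+ n) / n%:R))%R.
  under [RHS]eq_bigr => f _ do rewrite mulrA mulr_sumr.
  rewrite -mulr_suml exchange_big /=.
  under [in RHS]eq_bigr => v _.
    under eq_bigr => f _ do rewrite mulrCA.
    rewrite -mulr_sumr (weight_marginal symH treeE v (fun x => d x ^+ n)%R).
    over.
  rewrite -mulr_suml -natr_sum -/n mulrAC divff ?mul1r ?pnatr_eq0 -?lt0n //.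
  rewrite natr_sum; apply: eq_bigr => x _.
  by rewrite natrX -def_n /= exprS.
apply: leif_sum => f col.
have w_gt0 : (0 < weight eH e f)%R.
  by apply: prodr_gt0 => v _; rewrite divr_gt0 ?exprn_gt0 // d_gt0.
rewrite (mono_leif (ler_pM2l w_gt0)).
have := weighted_AGM n_gt0 (fun v => ltW (d_gt0 f v col)).
congr (_ <= _ ?= iff _)%R.
by do 2![apply: eq_forallb => ?]; rewrite !ltn_predRL eqr_nat.
Qed.

(** Color the two classes of the bipartition of the tree by x and y. *)
Lemma edge_hcoloring u v x y : e u v -> eH x y ->
  exists2 f : {ffun V -> W}, is_hcoloring e eH f & f u = x /\ f v = y.
Proof.
move=> euv exy; have [c cP] := tree_bipartite treeE.
exists [ffun w => if c w == c u then x else y]; last first.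
  by rewrite !ffunE eqxx [c v == _]eq_sym (negbTE (cP _ _ euv)).
apply/'forall_'forall_implyP=> w w' /cP; rewrite !ffunE.
by case: (c w) (c w') (c u) => [] [] [] //= _; rewrite symH.
Qed.

End TreeHom.

(** Any bijection works once it is corrected by a transposition that sends c to
the center of the star. *)
Lemma star_of_center (V : finType) (e : rel V) (c : V) :
  (forall u v, e u v = ((u == c) != (v == c))) -> graph_iso e (star #|V|).
Proof.
move=> eE; have V_gt0 : 0 < #|V| by apply/card_gt0P; exists c.
pose T : finType := ('I_1 + 'I_(#|V|.-1))%type.
have cardT : #|V| = #|T| by rewrite card_sum !card_ord add1n prednK.
pose f0 x : T := enum_val (cast_ord cardT (enum_rank x)).
have f0_bij : bijective f0.
  apply: inj_card_bij; last by rewrite cardT.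
  by move=> x y /enum_val_inj/cast_ord_inj/enum_rank_inj.
pose f x := tperm (f0 c) (inl ord0) (f0 x).
have f_bij : bijective f by apply: (bij_comp _ f0_bij); apply: injF_bij perm_inj.
exists f => // u v; rewrite eE.
have fc w : (w == c) = (f w == inl ord0).
  rewrite -(bij_eq f_bij); congr (_ == _).
  by rewrite /f tpermL.
rewrite !fc /star; case: (f u) (f v) => [i|i] [j|j]; rewrite -?[i]ord1 //=.
- by rewrite (ord1 i) (ord1 j).
- by rewrite (ord1 i).
by rewrite (ord1 j).
Qed.

(** Some vertex c is internal because the degrees add up to 2n - 2 > n.  If no
neighbour of c is internal, then each of them is adjacent to c alone, so c and
its neighbours form a connected component, that is, the whole tree. *)
Lemma star_or_adjacent_internal (V : finType) (e : rel V) :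
  is_tree e -> 2 < #|V| ->
  graph_iso e (star #|V|) \/
  exists u v, [/\ e u v, 1 < degree e u & 1 < degree e v].
Proof.
move=> treeE V_gt2; have [symE irrE [_ conE] _] := treeE.
have [/existsP[u /existsP[v /and3P[]]]|noadj] :=
  boolP [exists u, exists v, [&& e u v, 1 < degree e u & 1 < degree e v]].
  by right; exists u, v.
left; have [c c_gt1] : exists c, 1 < degree e c.
  apply/existsP; apply: contraTT V_gt2 => /existsPn deg_le1.
  have: \sum_v degree e v <= \sum_(v : V) 1.
    by apply: leq_sum => v _; rewrite leqNgt deg_le1.
  rewrite (sum1_card V) -(leq_add2l 2) add2n tree_handshake // -addnn.
  by rewrite leq_add2r leqNgt.
have leaf v w : e c v -> e v w -> w = c.
  move=> ecv evw; move/existsPn/(_ c)/existsPn/(_ v): noadj.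
  rewrite ecv c_gt1 /= -leqNgt => /card_le1_eqP; apply; rewrite inE //.
  by rewrite symE.
have near_closed p u :
    (u == c) || e c u -> path e u p -> (last u p == c) || e c (last u p).
  elim: p u => //= w p IHp u uc /andP[euw]; apply: IHp.
  case/predU1P: uc euw => [-> ->|ecu euw]; first by rewrite orbT.
  by rewrite (leaf u w) ?eqxx.
have all_nbr v : (v == c) || e c v.
  have /connectP[p cp ->] := conE c v.
  by apply: near_closed cp; rewrite eqxx.
apply: (@star_of_center _ _ c) => u v.
have [->|u'c] := eqVneq u c.
  have [->|v'c] := eqVneq v c; first by rewrite irrE.
  by have := all_nbr v; rewrite (negbTE v'c).
have := all_nbr u; rewrite (negbTE u'c) /= => ecu.
have [->|v'c] := eqVneq v c; first by rewrite symE.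
by apply: contraNF v'c => /(leaf _ _ ecu)->.
Qed.

Theorem theorem1p3 (W : finType) (eH : rel W) (symH : symmetric eH) :
  exists cH : nat,
    forall (n : nat) (V : finType) (eT : rel V),
      cH <= n -> is_tree eT -> #|V| = n ->
      hom eT eH <= hom (star n) eH /\
      (hom eT eH = hom (star n) eH <->
       components_regular eH \/ graph_iso eT (star n)).
Proof.
exists 3 => n V eT n_gt2 treeT cardV; rewrite -{}cardV in n_gt2 *.
have [] := hom_tree_leif treeT symH n_gt2.
rewrite -hom_star // ler_nat eqr_nat => le_hom eq_hom; split=> //.
split=> [/eqP|[/components_regularP reg|]]; last exact: hom_graph_iso.
  rewrite eq_hom => /forall_inP eq_deg.
  have [|[u [v [euv u_gt1 v_gt1]]]] := star_or_adjacent_internal treeT n_gt2.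
    by right.
  left; apply/components_regularP => x y exy.
  have [f colf [<- <-]] := edge_hcoloring treeT symH euv exy.
  have /forallP/(_ u)/forallP/(_ v) := eq_deg f colf.
  by rewrite u_gt1 v_gt1 => /eqP.
apply/eqP; rewrite eq_hom; apply/forall_inP => f colf.
apply/forallP=> u; apply/forallP=> v; apply/implyP=> _; apply/eqP.
by have [_ _ conT _] := treeT; apply: hcoloring_connected_eq conT reg colf _ _.
Qed.
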